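(* Let $d\ge 2$ and $\varepsilon\in(0,1]$. There exist constants $C_1,C_3\in(0,\infty)$, depending only on $d$ and $\varepsilon$, such that the following holds. Let $X$ be any fixed everywhere percolating subgraph of $\mathbb{Z}^d$, and let $Y=X\cup\omega$, where $\omega$ is an $\varepsilon$-Bernoulli percolation on $\mathbb{Z}^d$. Then for every integer $n\ge 1$, $$\mathbb{P}\big[\text{for all } x,y\in\Lambda_n,\ x \text{ is } Y\text{-connected to } y \text{ inside } \Lambda_{2n}\big]\ \ge\ 1-C_3e^{-C_1\sqrt n}.$$
   Context: Let $\mathbb{E}^d$ be the set of nearest-neighbour edges of $\mathbb{Z}^d$. A subgraph of $\mathbb{Z}^d$ is a set of edges $X\subset\mathbb{E}^d$, identified with the graph $(\mathbb{Z}^d,X)$. It is everywhere percolating if all connected components of $(\mathbb{Z}^d,X)$ are infinite. For $r>0$, $\Lambda_r=[-r,r]^d\cap\mathbb{Z}^d$. Two vertices are $Y$-connected inside $S\subset\mathbb{Z}^d$ if they are joined by a path of edges of $Y$ all of whose vertices lie in $S$. An $\varepsilon$-Bernoulli percolation is the random set $\omega\subset\mathbb{E}^d$ containing each edge of $\mathbb{E}^d$ independently with probability $\varepsilon$. *)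

(* Defs.v *)
From HB Require Import structures.
From mathcomp Require Import all_boot all_order all_algebra finmap.
From mathcomp Require Import all_classical all_reals all_analysis.

Set Implicit Arguments.
Unset Strict Implicit.
Unset Printing Implicit Defensive.

Import Order.TTheory GRing.Theory Num.Theory.

Local Open Scope classical_set_scope.
Local Open Scope ring_scope.

Notation vertex d := 'rV[int]_d.
(* Potential edges are finite sets of vertices; the genuine edges are the
   two-point sets singled out by [lattice_edges]. *)
Notation edge d := {fset 'rV[int]_d}.

Definition nearest_neighbours (d : nat) (x y : vertex d) : Prop :=
  \sum_(i < d) `|x 0 i - y 0 i| = 1.

Definition lattice_edges (d : nat) : set (edge d) :=
  [set e : edge d | exists x y : vertex d,
     nearest_neighbours x y /\ e = [fset x; y]%fset].
Arguments lattice_edges : clear implicits.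

Definition is_subgraph (d : nat) (X : set (edge d)) : Prop :=
  X `<=` lattice_edges d.

Definition connected_inside (d : nat) (Y : set (edge d)) (S : set (vertex d))
    (x y : vertex d) : Prop :=
  exists p : seq (vertex d),
    [/\ path (fun u v => [fset u; v]%fset \in Y) x p,
        last x p = y
      & [set` x :: p] `<=` S].

Definition component (d : nat) (X : set (edge d)) (x : vertex d) :
    set (vertex d) :=
  [set y : vertex d | connected_inside X setT x y].

Definition everywhere_percolating (d : nat) (X : set (edge d)) : Prop :=
  forall x : vertex d, infinite_set (component X x).

Definition box (d r : nat) : set (vertex d) :=
  [set x : vertex d | forall i : 'I_d, `|x 0 i| <= r%:Z].
Arguments box : clear implicits.

Definition mutually_independent (R : realType) (disp : measure_display)
    (T : measurableType disp) (P : probability T R)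
    (I : choiceType) (D : set I) (E : I -> set T) : Prop :=
  forall J : {fset I}, [set` J] `<=` D ->
    P (\bigcap_(i in [set` J]) E i) = (\prod_(i <- J) P (E i))%E.

Definition edge_open (d : nat) (T : Type) (omega : T -> set (edge d))
    (e : edge d) : set T :=
  [set t | omega t e].

Definition bernoulli_percolation (R : realType) (disp : measure_display)
    (T : measurableType disp) (P : probability T R) (d : nat) (eps : R)
    (omega : T -> set (edge d)) : Prop :=
  [/\ forall t, is_subgraph (omega t),
      forall e, lattice_edges d e -> measurable (edge_open omega e),
      forall e, lattice_edges d e -> P (edge_open omega e) = eps%:E
    & mutually_independent P (lattice_edges d) (edge_open omega)].

(* Main.v *)
Require Import Defs.
From HB Require Import structures.
From mathcomp Require Import all_boot all_order all_algebra finmap.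
From mathcomp Require Import all_classical all_reals all_analysis.
From mathcomp Require Import zify ring lra.

Set Implicit Arguments.
Unset Strict Implicit.
Unset Printing Implicit Defensive.

Import Order.TTheory GRing.Theory Num.Theory.

Local Open Scope classical_set_scope.
Local Open Scope ring_scope.

(** The sprinkled edges are examined sphere by sphere (for the sup-norm), from
    radius [N = 2n] down to radius [n], in [K] stages of [L] consecutive
    spheres, with [K] and [L] both equal to the integer part of the square root
    of [n]; only the edges lying inside a single sphere are used.

    Let [Y_k] be [X] together with the open edges found in the first [k]
    stages, and let [R_k = N - k * L]. Unless the box of radius [n] is already
    connected, every cluster of [Y_k] in the box of radius [N] that meets the
    box of radius [R_k] has at least [2 ^ k] vertices ([cluster_growth]).
    Indeed, let [C] be such a cluster meeting the smaller box of radius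
    [R_{k+1}]. Components of [X] are infinite, so [C] meets each of the [L]
    spheres examined at stage [k + 1] ([exit_to_sphere]).
    - If [C] covers one of these spheres, it contains every vertex inside it,
      since each of them is joined to that sphere by [X] ([covered_sphere]).
    - Otherwise, spheres being connected in dimension at least two
      ([sphere_connected]), each of the [L] spheres carries an edge from [C] to
      its complement. The choice of these edges depends only on what was
      examined before, so by independence they are all closed with probability
      [(1 - eps) ^ L] ([closed_after_revealing]). If one of them is open, it
      merges [C] with another cluster meeting the box of radius [R_k], and the
      size at least doubles ([stage_merges]).

    After [K] stages the clusters would have more vertices than the box has, as
    soon as [2 ^ K > (2N + 1) ^ d]. Hence the box of radius [n] is connected
    except with probability at most [K * (2N + 1) ^ d * (1 - eps) ^ L], which
    is a polynomial factor times an exponential in the square root of [n]. *)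

(** * Paths inside a set of vertices *)

Lemma connected_refl d (Y : set (edge d)) (S : set (vertex d)) x :
  S x -> connected_inside Y S x x.
Proof. by move=> Sx; exists [::]; split=> // z /=; rewrite inE => /eqP ->. Qed.

Lemma connected_edge d (Y : set (edge d)) (S : set (vertex d)) x y :
  S x -> S y -> Y [fset x; y]%fset -> connected_inside Y S x y.
Proof.
move=> Sx Sy Yxy; exists [:: y]; split=> //=; first by rewrite andbT inE.
by move=> z /=; rewrite !inE => /orP[] /eqP ->.
Qed.

Lemma connected_trans d (Y : set (edge d)) (S : set (vertex d)) x y z :
  connected_inside Y S x y -> connected_inside Y S y z ->
  connected_inside Y S x z.
Proof.
move=> [p [pP pl pS]] [q [qP ql qS]]; exists (p ++ q); split.
- by rewrite cat_path pP pl.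
- by rewrite last_cat pl.
- move=> w /=; rewrite inE mem_cat orbA => /orP[wp|wq].
    by apply: pS; rewrite /= inE.
  by apply: qS; rewrite /= inE wq orbT.
Qed.

Lemma connected_mono d (Y Y' : set (edge d)) (S S' : set (vertex d)) x y :
  Y `<=` Y' -> S `<=` S' ->
  connected_inside Y S x y -> connected_inside Y' S' x y.
Proof.
move=> YY SS [p [pP pl pS]]; exists p; split=> //.
- by apply: sub_path pP => u v; rewrite !inE; apply: YY.
- by move=> w /pS /SS.
Qed.

Lemma connected_ends d (Y : set (edge d)) (S : set (vertex d)) x y :
  connected_inside Y S x y -> S x /\ S y.
Proof.
move=> [p [_ <- pS]]; split; apply: pS => /=; last exact: mem_last.
exact: mem_head.
Qed.

Lemma connected_ind d (Y : set (edge d)) (S : set (vertex d))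
    (Q : vertex d -> vertex d -> Prop) :
  (forall x, S x -> Q x x) ->
  (forall x u y, S x -> S u -> Y [fset x; u]%fset ->
     connected_inside Y S u y -> Q u y -> Q x y) ->
  forall x y, connected_inside Y S x y -> Q x y.
Proof.
move=> Q0 QS x y [p]; elim: p x => [|u p IH] x [] /=.
  by move=> _ <- pS; apply/Q0/pS; rewrite /= mem_head.
move=> /andP[]; rewrite inE => Yxu pP pl pS.
have pS' : [set` u :: p] `<=` S.
  by move=> w /= wp; apply: pS; rewrite /= inE wp orbT.
apply: (QS x u) => //.
- by apply: pS; rewrite /= mem_head.
- by apply: pS'; rewrite /= mem_head.
- by exists p.
- exact: IH.
Qed.

Lemma connected_sym d (Y : set (edge d)) (S : set (vertex d)) x y :
  connected_inside Y S x y -> connected_inside Y S y x.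
Proof.
move: x y; apply: connected_ind => [x|x u y Sx Su Yxu _ uy].
  exact: connected_refl.
by apply: (connected_trans uy); apply: connected_edge; rewrite // fsetUC.
Qed.

(** With [C] a box this follows a cluster until it exits; with [C] a cluster
    it finds a boundary edge of [C]. *)
Lemma connected_crossing d (Y : set (edge d)) (S C : set (vertex d)) x y :
  connected_inside Y S x y -> C x -> ~ C y ->
  exists u v, [/\ connected_inside Y (S `&` C) x u, S v, C u, ~ C v
                & Y [fset u; v]%fset].
Proof.
move: x y; apply: connected_ind => [//|x u y Sx Su Yxu _ IH Cx nCy].
have [Cu|nCu] := pselect (C u); last first.
  by exists x, u; split=> //; apply: connected_refl.
have [a [b [ua Sb Ca nCb Yab]]] := IH Cu nCy; exists a, b; split=> //.
by apply: connected_trans ua; apply: connected_edge.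
Qed.

Lemma connected_agree d (Y Y' : set (edge d)) (S : set (vertex d)) x y :
  (forall u v, S u -> S v -> Y [fset u; v]%fset -> Y' [fset u; v]%fset) ->
  connected_inside Y S x y -> connected_inside Y' S x y.
Proof.
move=> YY; move: x y; apply: connected_ind => [x|x u y Sx Su Yxu _ uy].
  exact: connected_refl.
by apply: connected_trans uy; apply: connected_edge => //; apply: YY.
Qed.

(** * Boxes and spheres *)

Definition sphere d r : set (vertex d) :=
  [set x | box d r x /\ exists i, `|x 0 i| = r%:Z].

Arguments sphere : clear implicits.

Lemma box_mono d r s : (r <= s)%N -> box d r `<=` box d s.
Proof. by move=> rs x xr i; apply: le_trans (xr i) _; rewrite lez_nat. Qed.

Lemma sphere_box d r : sphere d r `<=` box d r.
Proof. by move=> x []. Qed.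

Lemma sphere_inj d r s x : sphere d r x -> sphere d s x -> r = s.
Proof.
move=> [xr [i ir]] [xs [j js]]; have := xr j; have := xs i.
by rewrite ir js !lez_nat => ? ?; apply/eqP; rewrite eqn_leq; apply/andP.
Qed.

Lemma lattice_edge_neighbours d (u v : vertex d) i :
  lattice_edges d [fset u; v]%fset -> `|u 0 i - v 0 i| <= 1.
Proof.
move=> [x [y [xy uv]]].
have bnd : `|x 0 i - y 0 i| <= 1.
  rewrite -xy (bigD1 i) //= lerDl; exact: sumr_ge0.
have : u \in [fset x; y]%fset by rewrite -uv !inE eqxx.
have : v \in [fset x; y]%fset by rewrite -uv !inE eqxx orbT.
by rewrite !inE => /orP[] /eqP -> /orP[] /eqP -> //; 
   rewrite ?subrr ?normr0 // distrC.
Qed.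

Lemma box_boundary d r (u v : vertex d) :
  lattice_edges d [fset u; v]%fset -> box d r u -> ~ box d r v ->
  sphere d r.+1 v.
Proof.
move=> uv ur; move=> /existsNP[i /negP]; rewrite -ltNge => ri.
have bnd j : `|v 0 j| <= r.+1%:Z.
  by have := lattice_edge_neighbours j uv; have := ur j; lia.
by split=> //; exists i; have := bnd i; lia.
Qed.

(** Coordinates are shifted by [r], which makes the box the image of a finite
    type, so that its points can be counted. *)
Definition box_point d r (f : {ffun 'I_d -> 'I_(2 * r)%N.+1}) : vertex d :=
  \row_i ((f i : nat)%:Z - r%:Z).

Definition fbox d r : {fset vertex d} := 
  [fset box_point f | f in {: {ffun 'I_d -> 'I_(2 * r)%N.+1}}]%fset.

Arguments fbox : clear implicits.

Lemma in_fbox d r x : reflect (box d r x) (x \in fbox d r).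
Proof.
rewrite /fbox; apply: (iffP (imfsetP _ _ _ _)) => [[f _ ->] i|xr].
  rewrite mxE; have := ltn_ord (f i); move: (nat_of_ord (f i)) => m; lia.
exists [ffun i => inord (absz (x 0 i + r%:Z))] => //.
apply/rowP => i; rewrite mxE ffunE; move: (xr i); rewrite ler_norml => xri.
have xr0 : 0 <= x 0 i + r%:Z by lia.
by rewrite inordK; [rewrite gez0_abs // addrK | rewrite -ltz_nat gez0_abs //; lia].
Qed.

Lemma card_fbox d r : (#|` fbox d r| <= (2 * r)%N.+1 ^ d)%N.
Proof.
apply: leq_trans (leq_imfset_card _ _ _) _.
by rewrite -cardE /= cardT -cardE card_ffun !card_ord.
Qed.

Lemma finite_box d r : finite_set (box d r).
Proof.
by apply/finite_fsetP; exists (fbox d r); apply/seteqP; split=> x /in_fbox.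
Qed.

(** * Connectivity of spheres and exit paths *)

Definition set_coord d (x : vertex d) i (c : int) : vertex d :=
  \row_k (if k == i then c else x 0 k).

Lemma set_coord_edge d (x : vertex d) i :
  lattice_edges d [fset x; set_coord x i (x 0 i + 1)]%fset.
Proof.
exists x, (set_coord x i (x 0 i + 1)); split=> //.
rewrite /nearest_neighbours (bigD1 i) //= big1 => [|k ki].
  by rewrite !mxE eqxx opprD addNKr normrN1 addr0.
by rewrite mxE (negbTE ki) subrr normr0.
Qed.

Lemma set_coord_sphere d r (x : vertex d) (i j : 'I_d) c :
  box d r x -> `|x 0 i| = r%:Z -> j != i -> `|c| <= r%:Z ->
  sphere d r (set_coord x j c).
Proof.
move=> xr xi ji cr; split=> [k|]; first by rewrite mxE; case: eqP.
by exists i; rewrite mxE eq_sym (negbTE ji).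
Qed.

(** The coordinate [i], fixed at absolute value [r], keeps the point on the
    sphere while the coordinate [j] is increased one unit at a time. *)
Lemma raise_coord d r (x : vertex d) (i j : 'I_d) :
  box d r x -> `|x 0 i| = r%:Z -> j != i ->
  connected_inside (lattice_edges d) (sphere d r) x (set_coord x j r%:Z).
Proof.
move=> xr xi ji; have [m mE] : exists m : nat, x 0 j = r%:Z - m%:Z.
  exists (absz (r%:Z - x 0 j)%R); rewrite gez0_abs ?subKr // subr_ge0.
  exact: le_trans (ler_norm _) (xr j).
elim: m x xr xi mE => [|m IH] x xr xi mE.
  suff -> : set_coord x j r%:Z = x by apply: connected_refl; split; [|exists i].
  by apply/rowP => k; rewrite mxE; case: eqP => // ->; rewrite mE subr0.
set y := set_coord x j (x 0 j + 1).
have [yr _] : sphere d r y.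
  by apply: set_coord_sphere ji _ => //; have := xr j; lia.
have yi : `|y 0 i| = r%:Z by rewrite mxE eq_sym (negbTE ji).
have yE : y 0 j = r%:Z - m%:Z by rewrite mxE eqxx mE; lia.
have -> : set_coord x j r%:Z = set_coord y j r%:Z.
  by apply/rowP => k; rewrite !mxE; case: eqP.
apply: connected_trans (IH y yr yi yE); apply: connected_edge.
- by split=> //; exists i.
- by split=> //; exists i.
- exact: set_coord_edge.
Qed.

Lemma raise_coords d r (x : vertex d) i (s : seq 'I_d) :
  box d r x -> `|x 0 i| = r%:Z -> i \notin s ->
  connected_inside (lattice_edges d) (sphere d r) x
    (\row_k (if k \in s then r%:Z else x 0 k)).
Proof.
move=> xr xi; elim: s => [_|j s IH].
  have -> : \row_k (if k \in [::] then r%:Z else x 0 k) = x.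
    by apply/rowP => k; rewrite mxE.
  by apply: connected_refl; split=> //; exists i.
rewrite inE negb_or => /andP[ij iNs]; have xy := IH iNs.
set y := (\row_k _) in xy; have [_ [yr _]] := connected_ends xy.
have -> : \row_k (if k \in j :: s then r%:Z else x 0 k) = set_coord y j r%:Z.
  by apply/rowP => k; rewrite !mxE inE; case: (k == j).
apply: connected_trans xy _; apply: (raise_coord (i := i)) => //.
- by rewrite mxE (negbTE iNs).
- by rewrite eq_sym.
Qed.

(** Every point can be joined to the corner with all coordinates [r]: a
    coordinate other than the extremal one is raised first, and it then keeps
    the point on the sphere while all others are raised. The existence of this
    second coordinate is where [d >= 2] enters. *)
Lemma sphere_connected d r (x y : vertex d) :
  (2 <= d)%N -> sphere d r x -> sphere d r y ->
  connected_inside (lattice_edges d) (sphere d r) x y.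
Proof.
move=> d2.
suff corner z : sphere d r z ->
    connected_inside (lattice_edges d) (sphere d r) z (const_mx r%:Z).
  by move=> /corner xc /corner yc; apply: connected_trans xc (connected_sym yc).
move=> [zr [i zi]].
have [j ji] : exists j : 'I_d, j != i.
  have d1 : (0 < d)%N by exact: ltnW.
  have [->|i0] := eqVneq i (Ordinal d1); first by exists (Ordinal d2).
  by exists (Ordinal d1); rewrite eq_sym.
have zw := raise_coord zr zi ji; set w := set_coord z j r%:Z in zw.
have [_ [wr _]] := connected_ends zw.
apply: connected_trans zw _.
have -> : const_mx r%:Z =
    \row_k (if k \in rem j (enum 'I_d) then r%:Z else w 0 k).
  apply/rowP => k; rewrite !mxE mem_rem_uniq ?enum_uniq // !inE mem_enum.
  by rewrite inE andbT; case: (k == j).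
apply: (raise_coords (i := j)) => //; first by rewrite mxE eqxx ger0_norm.
by rewrite mem_rem_uniq ?enum_uniq // !inE eqxx.
Qed.

Definition shell_gap d r (C : set (vertex d)) : set (edge d) :=
  [set e | exists u v, [/\ e = [fset u; v]%fset, lattice_edges d e,
     sphere d r u /\ sphere d r v & C u /\ ~ C v]].

Lemma shell_gap_exists d r (C : set (vertex d)) x :
  (2 <= d)%N -> sphere d r x -> C x -> ~ sphere d r `<=` C ->
  shell_gap r C !=set0.
Proof.
move=> d2 xr Cx /existsNP[y /not_implyP[yr nCy]].
have [u [v [xu vr Cu nCv uv]]] :=
  connected_crossing (sphere_connected d2 xr yr) Cx nCy.
have [_ [ur _]] := connected_ends xu.
by exists [fset u; v]%fset, u, v.
Qed.

(** An infinite cluster leaves every box, and its first vertex outside the box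
    of radius [r] lies on the sphere of radius [r + 1]. *)
Lemma exit_to_sphere d (X : set (edge d)) r x :
  is_subgraph X -> everywhere_percolating X -> box d r x ->
  exists2 y, sphere d r.+1 y & connected_inside X (box d r.+1) x y.
Proof.
move=> Xlat Xperc xr.
have [y xy yNr] : exists2 y, component X x y & ~ box d r y.
  apply: contrapT => /forall2NP noy; apply: (Xperc x).
  apply: sub_finite_set (finite_box d r) => y xy.
  by case: (noy y) => // /contrapT.
have [u [v [xu _ ur vNr uv]]] := connected_crossing xy xr yNr.
have vS := box_boundary (Xlat _ uv) ur vNr.
exists v => //; apply: (connected_trans (y := u)).
  by apply: connected_mono xu => // z [_]; apply: box_mono.
apply: connected_edge => //; first exact: box_mono ur.
exact: sphere_box.
Qed.

(** * Revealing finitely many edges *)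

Definition cylinder d (T : Type) (omega : T -> set (edge d))
    (O C : {fset edge d}) : set T :=
  [set t | [set` O] `<=` omega t /\ [set` C] `<=` ~` omega t].

Definition trace d (F : {fset edge d}) (Y : set (edge d)) : {fset edge d} :=
  [fset e in F | e \in Y]%fset.

Lemma in_trace d (F : {fset edge d}) (Y : set (edge d)) e :
  e \in trace F Y <-> e \in F /\ Y e.
Proof.
rewrite !inE /=; split=> [/andP[-> eY]|[-> Ye]]; first by split=> //; apply/set_mem.
by apply/mem_set.
Qed.

Lemma trace_sub d (F : {fset edge d}) (Y : set (edge d)) :
  (trace F Y `<=` F)%fset.
Proof. by apply/fsubsetP => e /in_trace[]. Qed.

(** Cylinders of this form partition the probability space according to the
    configuration on [F]. *)
Lemma cylinder_trace d (T : Type) (omega : T -> set (edge d))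
    (F a : {fset edge d}) t :
  (a `<=` F)%fset -> cylinder omega a (F `\` a)%fset t <-> trace F (omega t) = a.
Proof.
move=> aF; split=> [[ao ac]|<-].
  apply/fsetP => e; apply/idP/idP => [/in_trace[eF eo]|ea].
    by apply: contrapT => /negP ea; apply: (ac e) => //=; rewrite in_fsetD ea.
  by apply/in_trace; split; [exact: (fsubsetP aF)|exact: ao].
split=> [e /in_trace[] //|e /=].
rewrite in_fsetD => /andP[/negP eNtr eF] eo; apply: eNtr.
by apply/in_trace.
Qed.

Section Revealing.
Context (R : realType) (disp : measure_display) (T : measurableType disp)
  (P : probability T R) (d : nat) (eps : R) (omega : T -> set (edge d)).
Hypothesis bern : bernoulli_percolation P eps omega.

Implicit Types O C : {fset edge d}.

(** Requiring [e] to be closed is the complement of requiring it to be open;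
    this reduces cylinders to the intersections of open-edge events to which
    mutual independence applies. *)
Lemma cylinder_fsetU1 O C e :
  cylinder omega O (e |` C)%fset =
  cylinder omega O C `\` cylinder omega (e |` O)%fset C.
Proof.
apply/seteqP; split=> t [].
  move=> tO tC; split; first by split=> // f fC; apply: tC; rewrite /= inE fC orbT.
  by case=> teO _; apply: (tC e) (teO e _); rewrite /= fset1U1.
move=> [tO tC] teO; split=> // f /=; rewrite in_fset1U => /orP[/eqP -> te|/tC //].
apply: teO; split=> // g /=; rewrite in_fset1U => /orP[/eqP -> //|/tO //].
Qed.

Lemma cylinder_fset0 O :
  cylinder omega O fset0 = \bigcap_(e in [set` O]) edge_open omega e.
Proof. by apply/seteqP; split=> [t [tO _] e /tO|t tO]. Qed.

Lemma measurable_cylinder O C :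
  [set` O] `<=` lattice_edges d -> [set` C] `<=` lattice_edges d ->
  measurable (cylinder omega O C).
Proof.
have [_ meas _ _] := bern.
elim/finSet_rect: C O => C IH O Olat Clat.
have [->|[e eC]] := fset_0Vmem C.
  rewrite cylinder_fset0; apply: fin_bigcap_measurable => // e /Olat; exact: meas.
rewrite -(fsetD1K eC) cylinder_fsetU1.
have eC1 : (C `\ e `<` C)%fset by rewrite fproperD1.
have C1lat : [set` (C `\ e)%fset] `<=` lattice_edges d.
  by move=> f /=; rewrite in_fsetD1 => /andP[_ /Clat].
apply: measurableD; apply: IH => // f /=.
by rewrite in_fset1U => /orP[/eqP -> |/Olat //]; apply: Clat.
Qed.

Lemma cylinder_prob O C :
  [set` O] `<=` lattice_edges d -> [set` C] `<=` lattice_edges d ->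
  [disjoint O & C]%fset ->
  P (cylinder omega O C) = (eps ^+ #|` O| * (1 - eps) ^+ #|` C|)%:E.
Proof.
have [_ meas prob indep] := bern.
elim/finSet_rect: C O => C IH O Olat Clat dis.
have [->|[e eC]] := fset_0Vmem C.
  rewrite cylinder_fset0 indep // cardfs0 expr0 mulr1.
  rewrite (eq_big_seq (fun=> eps%:E)) => [|f fO]; last exact/prob/Olat.
  by rewrite prodEFin big_const_seq count_predT iter_mulr_1.
have eO : e \notin O by apply: (fdisjointP_sym dis).
rewrite -(fsetD1K eC) cylinder_fsetU1.
have eC1 : (C `\ e `<` C)%fset by rewrite fproperD1.
have C1lat : [set` (C `\ e)%fset] `<=` lattice_edges d.
  by move=> f /=; rewrite in_fsetD1 => /andP[_ /Clat].
have O1lat : [set` (e |` O)%fset] `<=` lattice_edges d.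
  by move=> f /=; rewrite in_fset1U => /orP[/eqP -> |/Olat //]; apply: Clat.
have dis0 : [disjoint O & C `\ e]%fset.
  by apply: fdisjointWr dis; apply: fsubD1set.
have dis1 : [disjoint e |` O & C `\ e]%fset.
  by rewrite fdisjointU1X dis0 in_fsetD1 eqxx.
rewrite measureD; [|exact: measurable_cylinder|exact: measurable_cylinder|].
  rewrite setIidr; last first.
    move=> t [tO tC]; split=> // f fO; apply: tO; rewrite /= in_fset1U.
    by rewrite (_ : f \in O) ?orbT.
  have PO := IH _ eC1 O Olat C1lat dis0.
  have PeO := IH _ eC1 (e |` O)%fset O1lat C1lat dis1.
  apply: eq_trans (congr2 (fun p q => (p - q)%E) PO PeO) _; rewrite -EFinB.
  rewrite !cardfsU1 eO in_fsetD1 eqxx /= !add1n !exprS; congr (_%:E).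
  by move: (eps ^+ _) ((1 - eps) ^+ _) => p q; ring.
by apply: le_lt_trans (probability_le1 P _) _; [exact: measurable_cylinder|exact: ltry].
Qed.

(** There are finitely many configurations on [F], each given by a cylinder. *)
Lemma measurable_trace (F : {fset edge d}) (Q : {fset edge d} -> Prop) :
  [set` F] `<=` lattice_edges d -> measurable [set t | Q (trace F (omega t))].
Proof.
move=> Flat.
have -> : [set t | Q (trace F (omega t))] =
    \bigcup_(a in [set a | (a `<=` F)%fset /\ Q a])
      cylinder omega a (F `\` a)%fset.
  apply/seteqP; split=> [t Qt|t [a [aF Qa]]].
    by exists (trace F (omega t)); [split=> //; exact: trace_sub|
      exact/cylinder_trace/erefl/trace_sub].
  by move=> /(cylinder_trace _ _ aF) /= ->.
apply: fin_bigcup_measurable => [|a [aF _]].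
  apply: (sub_finite_set _ (finite_fset (fpowerset F))) => a [aF _] /=.
  by rewrite fpowersetE.
apply: measurable_cylinder => e /= ea; apply: Flat; first exact: (fsubsetP aF).
by move: ea; rewrite /= in_fsetD => /andP[].
Qed.

(** This is where independence enters. Once the configuration on [F] is fixed,
    the set [K] chosen from it is a deterministic set of [L] edges outside [F],
    all closed with conditional probability [(1 - eps) ^+ L]; this is then
    averaged over the configurations satisfying [G]. *)
Lemma closed_after_revealing (F : {fset edge d}) L
    (G : {fset edge d} -> Prop) (K : {fset edge d} -> {fset edge d}) :
  [set` F] `<=` lattice_edges d -> eps <= 1 ->
  (forall a, (a `<=` F)%fset -> G a ->
    [/\ [set` K a] `<=` lattice_edges d, [disjoint K a & F]%fset
      & #|` K a| = L]) ->
  let B := [set t | G (trace F (omega t)) /\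
                    [set` K (trace F (omega t))] `<=` ~` omega t] in
  measurable B /\ (P B <= ((1 - eps) ^+ L)%:E)%E.
Proof.
move=> Flat eps1 GK B.
pose D := [set a | (a `<=` F)%fset /\ G a].
have finD : finite_set D.
  apply: (sub_finite_set _ (finite_fset (fpowerset F))) => a [aF _] /=.
  by rewrite fpowersetE.
have BE : B = \bigcup_(a in D) cylinder omega a (F `\` a `|` K a)%fset.
  apply/seteqP; split=> [t [Gt Kt]|t [a [aF Ga] [ao ac]]].
    exists (trace F (omega t)); first by split=> //; exact: trace_sub.
    have [_ /(_ erefl)[tO tC]] := cylinder_trace omega t (trace_sub F (omega t)).
    by split=> // e /=; rewrite in_fsetU => /orP[/tC|/Kt].
  have trE : trace F (omega t) = a.
    apply/cylinder_trace => //; split=> // e eFa.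
    by apply: ac; rewrite /= in_fsetU (_ : e \in _).
  rewrite /B /= trE; split=> // e eK.
  by apply: ac; rewrite /= in_fsetU (_ : e \in K a) ?orbT.
have alat a : (a `<=` F)%fset -> [set` a] `<=` lattice_edges d.
  by move=> /fsubsetP aF e /= /aF /Flat.
have Falat a : [set` (F `\` a)%fset] `<=` lattice_edges d.
  by move=> e /=; rewrite in_fsetD => /andP[_ /Flat].
have mcyl a : D a -> measurable (cylinder omega a (F `\` a `|` K a)%fset).
  move=> [aF Ga]; have [Klat _ _] := GK a aF Ga.
  apply: measurable_cylinder => [|e /=]; first exact: alat.
  by rewrite in_fsetU => /orP[/Falat|/Klat].
have mcyl0 a : D a -> measurable (cylinder omega a (F `\` a)%fset).
  by move=> [aF Ga]; apply: measurable_cylinder => //; exact: alat.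
have triv0 : trivIset D (fun a => cylinder omega a (F `\` a)%fset).
  move=> a b [aF _] [bF _] [t [/(cylinder_trace _ _ aF) + /(cylinder_trace _ _ bF)]].
  by move=> -> ->.
have cyl_sub a :
    cylinder omega a (F `\` a `|` K a)%fset `<=` cylinder omega a (F `\` a)%fset.
  move=> t [ao ac]; split=> // e eFa.
  by apply: ac; rewrite /= in_fsetU (_ : e \in _).
have triv : trivIset D (fun a => cylinder omega a (F `\` a `|` K a)%fset).
  by move=> a b Da Db [t [/cyl_sub ta /cyl_sub tb]]; apply: triv0 => //; exists t.
split; first by rewrite BE; exact: fin_bigcup_measurable.
rewrite BE measure_fin_bigcup //.
have -> : (\sum_(a \in D) P (cylinder omega a (F `\` a `|` K a)%fset) =
    \sum_(a \in D) P (cylinder omega a (F `\` a)%fset) * ((1 - eps) ^+ L)%:E)%E.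
  apply: eq_fsbigr => a /set_mem[aF Ga]; have [Klat disK cardK] := GK a aF Ga.
  have disa : [disjoint a & F `\` a]%fset.
    by apply/fdisjointP => e ea; rewrite in_fsetD ea.
  have disaK : [disjoint a & K a]%fset.
    by apply: (fdisjointWl aF); rewrite fdisjoint_sym.
  have FKlat : [set` (F `\` a `|` K a)%fset] `<=` lattice_edges d.
    by move=> e /=; rewrite in_fsetU => /orP[/Falat|/Klat].
  have disFK : [disjoint a & F `\` a `|` K a]%fset by rewrite fdisjointXU disa.
  rewrite (cylinder_prob (alat a aF) (Falat a) disa).
  rewrite (cylinder_prob (alat a aF) FKlat disFK).
  rewrite cardfsU (_ : (_ `&` K a)%fset = fset0); last first.
    apply/eqP; apply: fdisjointWl _; last by rewrite fdisjoint_sym; exact: disK.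
    exact: fsubsetDl.
  by rewrite cardfs0 subn0 cardK exprD -EFinM mulrA.
rewrite -ge0_mule_fsuml // -measure_fin_bigcup //.
rewrite -[leRHS]mul1e; apply: lee_wpmul2r.
  by rewrite lee_fin exprn_ge0 // subr_ge0.
by apply: probability_le1; exact: fin_bigcup_measurable.
Qed.

Lemma prob_bigcup_bound (I : choiceType) (s : seq I) (A : I -> set T) (c : R) :
  (forall i, measurable (A i) /\ (P (A i) <= c%:E)%E) ->
  let B := \bigcup_(i in [set` s]) A i in
  measurable B /\ (P B <= ((size s)%:R * c)%:E)%E.
Proof.
move=> Ac; elim: s => [|i s [mB PB]] /=.
  by rewrite (_ : [set` _] = set0) ?bigcup_set0 ?measure0 ?mul0r // -subset0.
have -> : \bigcup_(j in [set` i :: s]) A j = A i `|` \bigcup_(j in [set` s]) A j.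
  apply/seteqP; split=> t.
    move=> [j /=]; rewrite inE => /orP[/eqP -> |js] tj; first by left.
    by right; exists j.
  move=> [ti|[j js tj]]; first by exists i => //=; rewrite mem_head.
  by exists j => //=; rewrite inE (_ : j \in s) ?orbT.
have [mi Pi] := Ac i; split; first exact: measurableU.
apply: le_trans (measureU2 _ _ _) _ => //.
by rewrite mulrSr mulrDl mul1r addrC EFinD leeD.
Qed.
End Revealing.

(** * Merging clusters from the outside inwards *)

Definition shell d r : set (edge d) :=
  [set e | exists u v, [/\ e = [fset u; v]%fset, lattice_edges d e,
     sphere d r u & sphere d r v]].
Arguments shell : clear implicits.

Definition layer d r N : set (edge d) :=
  [set e | exists2 s, (r < s <= N)%N & shell d s e].
Arguments layer : clear implicits.

Definition box_edges d N : set (edge d) :=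
  [set e | lattice_edges d e /\ exists u v,
     [/\ e = [fset u; v]%fset, box d N u & box d N v]].
Arguments box_edges : clear implicits.

Lemma shell_inj d r s e : shell d r e -> shell d s e -> r = s.
Proof.
move=> [u [v [-> _ ur vr]]] [u' [v' [uv _ us vs]]].
have : u \in [fset u'; v']%fset by rewrite -uv !inE eqxx.
rewrite !inE => /orP[] /eqP uE; rewrite uE in ur; exact: (sphere_inj ur).
Qed.

Lemma shell_gap_shell d r (C : set (vertex d)) : shell_gap r C `<=` shell d r.
Proof. by move=> e [u [v [-> uv [ur vr] _]]]; exists u, v. Qed.

Lemma layer_box_edges d r N : layer d r N `<=` box_edges d N.
Proof.
move=> e [s /andP[_ sN] [u [v [-> uv us vs]]]]; split=> //; exists u, v.
by split=> //; apply: (box_mono sN); apply: sphere_box.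
Qed.

Lemma finite_box_edges d N : finite_set (box_edges d N).
Proof.
apply: sub_finite_set (finite_image2 (fun u v => [fset u; v]%fset)
  (finite_box d N) (finite_box d N)).
by move=> e [_ [u [v [-> uN vN]]]]; exists u => //; exists v.
Qed.

Lemma finite_layer d r N : finite_set (layer d r N).
Proof. exact: sub_finite_set (@layer_box_edges d r N) (finite_box_edges d N). Qed.

Definition flayer d r N : {fset edge d} := fset_set (layer d r N).
Arguments flayer : clear implicits.

Lemma in_flayer d r N e : e \in flayer d r N <-> layer d r N e.
Proof. by rewrite in_fset_set ?inE //; exact: finite_layer. Qed.

Definition box_cluster d (Y : set (edge d)) N (x : vertex d) : set (vertex d) :=
  [set y | connected_inside Y (box d N) x y].

(** The part of the sprinkled graph that is known once the spheres have been
    examined from radius [N] down to, but not including, radius [r]. *)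
Definition revealed d (X : set (edge d)) r N (om : set (edge d)) :
    set (edge d) := X `|` [set` trace (flayer d r N) om].

Lemma revealed_mono d (X : set (edge d)) r s N om :
  (s <= r)%N -> revealed X r N om `<=` revealed X s N om.
Proof.
move=> sr e [Xe|/= /in_trace[/in_flayer[q /andP[rq qN] qe] eo]]; first by left.
right; apply/in_trace; split=> //; apply/in_flayer; exists q => //.
by rewrite qN (leq_ltn_trans sr rq).
Qed.

Lemma revealed_sub d (X : set (edge d)) r N om :
  revealed X r N om `<=` X `|` om.
Proof. by move=> e [Xe|/= /in_trace[_ eo]]; [left|right]. Qed.

(** Choosing a single edge per sphere fixes the number of edges to [L], whatever
    the shape of [C]. Where the gap is empty, [fset0] is a dummy value. *)
Definition gap_edges d s L (C : set (vertex d)) : {fset edge d} :=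
  [fset xget fset0 (shell_gap r C) | r in iota s.+1 L]%fset.

Definition stage_gaps d s L (C : set (vertex d)) :=
  forall r, (s < r <= s + L)%N -> shell_gap r C !=set0.

Lemma gap_edgesP d s L (C : set (vertex d)) :
  stage_gaps s L C -> forall r, (s < r <= s + L)%N ->
  shell_gap r C (xget fset0 (shell_gap r C)).
Proof. by move=> gaps r /gaps [e re]; apply: xgetPex; exists e. Qed.

Lemma gap_edges_spec d s L N (C : set (vertex d)) : stage_gaps s L C ->
  [/\ [set` gap_edges s L C] `<=` lattice_edges d,
      [disjoint gap_edges s L C & flayer d (s + L) N]%fset
    & #|` gap_edges s L C| = L].
Proof.
move=> gaps; have gapP := gap_edgesP gaps.
have rng r : r \in iota s.+1 L -> (s < r <= s + L)%N.
  by rewrite mem_iota addSn ltnS.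
have mem e : e \in gap_edges s L C ->
    exists2 r, (s < r <= s + L)%N & shell_gap r C e.
  by move=> /imfsetP[r /= /rng rsL ->]; exists r => //; apply: gapP.
split.
- by move=> e /= /mem[r _ [u [v []]]].
- apply/fdisjointP => e /mem[r /andP[_ rsL] /shell_gap_shell er].
  apply/negP => /in_flayer[q /andP[sLq _] eq].
  by move: sLq; rewrite -(shell_inj er eq) ltnNge rsL.
- rewrite card_in_imfset /= ?undup_id ?iota_uniq ?size_iota // => r q rs qs rq.
  apply: (@shell_inj d r q (xget fset0 (shell_gap r C))).
    by apply/shell_gap_shell/gapP/rng.
  by rewrite rq; apply/shell_gap_shell/gapP/rng.
Qed.

(** The configuration [om] enters [C] only through spheres of radius greater
    than [s + L], whereas the gap edges have radius at most [s + L]. *)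
Definition stage_failure d (X : set (edge d)) s L N x (om : set (edge d)) :=
  let C := box_cluster (revealed X (s + L) N om) N x in
  stage_gaps s L C /\ [set` gap_edges s L C] `<=` ~` om.

Definition box_connected d (X om : set (edge d)) n N :=
  forall x y : vertex d, box d n x -> box d n y ->
    connected_inside (X `|` om) (box d N) x y.

Section Merging.
Context (d : nat) (X : set (edge d)).
Hypotheses (d2 : (2 <= d)%N) (Xlat : is_subgraph X)
  (Xperc : everywhere_percolating X).

(** Every vertex of the small box is joined by [X] to the sphere of radius [r],
    hence belongs to the cluster covering that sphere. *)
Lemma covered_sphere r N n (om : set (edge d)) (Y : set (edge d)) x :
  (n < r <= N)%N -> X `<=` Y -> Y `<=` X `|` om ->
  sphere d r `<=` box_cluster Y N x -> box_connected X om n N.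
Proof.
case: r => [//|r] /andP[nr rN] XY YXo cov.
suff toC u : box d n u -> box_cluster Y N x u.
  move=> u v /toC xu /toC xv; apply: (connected_mono YXo (fun _ => id)).
  exact: connected_trans (connected_sym xu) xv.
move=> un; have ur : box d r u by apply: box_mono un.
have [y yr uy] := exit_to_sphere Xlat Xperc ur.
apply: connected_trans (cov _ yr) _; apply: connected_sym.
exact: connected_mono XY (@box_mono d _ _ rN) uy.
Qed.

(** The new vertex [v] lies on one of the spheres just examined. Its cluster
    before the merging thus meets the box of radius [s + L], which is what lets
    the size estimate apply to it although it may not reach radius [s]. *)
Lemma stage_merges s L N n x (om : set (edge d)) :
  (n <= s)%N -> (s + L <= N)%N -> box d s x ->
  ~ box_connected X om n N -> ~ stage_failure X s L N x om ->
  exists v, [/\ box d (s + L) v,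
    ~ box_cluster (revealed X (s + L) N om) N x v
    & box_cluster (revealed X s N om) N x v].
Proof.
move=> ns sLN xs disc; set C := box_cluster _ N x => ok.
have Xrev r : X `<=` revealed X r N om by move=> e; left.
have gaps : stage_gaps s L C.
  case=> [//|r] /andP[sr rsL]; have rN := leq_trans rsL sLN.
  have xr : box d r x by apply: box_mono xs.
  have [y yr xy] := exit_to_sphere Xlat Xperc xr.
  apply: (shell_gap_exists (x := y)) => // [|cov].
    exact: connected_mono (Xrev _) (@box_mono d _ _ rN) xy.
  apply: disc; apply: (covered_sphere _ (Xrev _) (@revealed_sub _ _ _ _ _) cov).
  by rewrite rN (leq_ltn_trans ns).
have [e egap eo] : exists2 e, e \in gap_edges s L C & om e.
  apply: contrapT => none; apply: ok; split=> // e /= ee eo.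
  by apply: none; exists e.
move: egap => /imfsetP[r /=]; rewrite mem_iota addSn ltnS => rsL eE.
have /andP[sr rsL'] := rsL; have rN := leq_trans rsL' sLN.
have := gap_edgesP gaps rsL; rewrite -eE => - [u [v [euv elat [ur vr] [Cu nCv]]]].
exists v; split=> //; first by apply: box_mono (sphere_box vr).
apply: (connected_trans (y := u)).
  by apply: connected_mono Cu => //; apply: revealed_mono; exact: leq_addr.
apply: connected_edge.
- exact: box_mono (sphere_box ur).
- exact: box_mono (sphere_box vr).
- right; apply/in_trace; rewrite -euv; split=> //; apply/in_flayer.
  by exists r; [rewrite sr rN|exists u, v].
Qed.

Definition cluster_fset (Y : set (edge d)) N x : {fset vertex d} :=
  [fset y in fbox d N | `[< box_cluster Y N x y >]]%fset.

Lemma in_cluster_fset (Y : set (edge d)) N x y :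
  y \in cluster_fset Y N x <-> box_cluster Y N x y.
Proof.
rewrite !inE /=; split=> [/andP[_ /asboolP //]|xy].
by apply/andP; split; [apply/in_fbox; case: (connected_ends xy)|apply/asboolP].
Qed.

(** The two clusters merged by a stage are disjoint and both met the previous
    box, so the bound for their union is twice the previous one. *)
Lemma cluster_growth n K L N (om : set (edge d)) :
  (n + K * L <= N)%N -> ~ box_connected X om n N ->
  (forall k x, (k < K)%N -> box d N x ->
     ~ stage_failure X (N - k.+1 * L) L N x om) ->
  forall k x, (k <= K)%N -> box d (N - k * L) x ->
  (2 ^ k <= #|` cluster_fset (revealed X (N - k * L) N om) N x|)%N.
Proof.
move=> nN disc ok; elim=> [|k IH] x kK xk.
  rewrite expn0 cardfs_gt0; apply/fset0Pn; exists x; apply/in_cluster_fset.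
  by apply: connected_refl; apply: box_mono xk; exact: leq_subr.
set s := (N - k.+1 * L)%N in xk *.
have kL : (k.+1 * L <= K * L)%N by rewrite leq_mul2r kK orbT.
have sE : (s + L = N - k * L)%N by rewrite /s mulSn; lia.
have ns : (n <= s)%N by rewrite /s; lia.
have sLN : (s + L <= N)%N by rewrite sE leq_subr.
have xN : box d N x by apply: box_mono xk; exact: leq_subr.
have [v [vs nCv C'v]] := stage_merges ns sLN xk disc (ok k x kK xN).
rewrite sE in vs nCv.
have xs : box d (N - k * L) x by rewrite -sE; apply: box_mono xk; exact: leq_addr.
have mono : revealed X (N - k * L) N om `<=` revealed X s N om.
  by apply: revealed_mono; rewrite -sE leq_addr.
have := IH x (ltnW kK) xs; have := IH v (ltnW kK) vs.
set A := cluster_fset _ N v; set B := cluster_fset _ N x => cA cB.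
have dis : [disjoint A & B]%fset.
  apply/fdisjointP => y /in_cluster_fset vy; apply/negP => /in_cluster_fset xy.
  by apply: nCv; apply: connected_trans xy (connected_sym vy).
apply: (@leq_trans #|` (A `|` B)%fset|).
  have /eqP AB0 : (A `&` B == fset0)%fset by [].
  by rewrite cardfsU AB0 cardfs0 subn0 expnS mul2n -addnn leq_add.
apply: fsubset_leq_card; apply/fsubsetP => y; rewrite in_fsetU.
move=> /orP[] /in_cluster_fset yy; apply/in_cluster_fset.
  by apply: connected_trans C'v _; apply: connected_mono yy.
by apply: connected_mono yy.
Qed.

(** Otherwise the cluster of the origin would outgrow the box. *)
Lemma all_stages_connect n K L N (om : set (edge d)) :
  (n + K * L <= N)%N -> ((2 * N).+1 ^ d < 2 ^ K)%N ->
  (forall k x, (k < K)%N -> box d N x ->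
     ~ stage_failure X (N - k.+1 * L) L N x om) ->
  box_connected X om n N.
Proof.
move=> nN dK ok; apply: contrapT => disc.
have z0 : box d (N - K * L) 0 by move=> i; rewrite mxE normr0.
have := cluster_growth nN disc ok (leqnn K) z0; rewrite leqNgt => /negP; apply.
apply: leq_ltn_trans dK; apply: leq_trans (card_fbox d N).
by apply: fsubset_leq_card; apply/fsubsetP => y; rewrite !inE => /andP[].
Qed.
End Merging.

(** * Union bound and numerical estimates *)

(** Connections inside the box only use edges of the box, so they depend on
    finitely many edges; this makes the connection event measurable. *)
Lemma box_connected_trace d (X Y : set (edge d)) n N :
  Y `<=` lattice_edges d ->
  box_connected X [set` trace (fset_set (box_edges d N)) Y] n N <->
  box_connected X Y n N.
Proof.
move=> Ylat; split=> conn x y xn yn; apply: connected_agree (conn x y xn yn).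
  by move=> u v _ _ [Xuv|/= /in_trace[_ Yuv]]; [left|right].
move=> u v uN vN [Xuv|Yuv]; [by left|right; apply/in_trace; split=> //].
rewrite in_fset_set; last exact: finite_box_edges.
by rewrite inE; split; [exact: Ylat|exists u, v].
Qed.

(** A union bound over the stages and over the starting points of clusters. *)
Lemma prob_box_connected (R : realType) (disp : measure_display)
    (T : measurableType disp) (P : probability T R) d (eps : R)
    (omega : T -> set (edge d)) (X : set (edge d)) n K L N :
  (2 <= d)%N -> eps <= 1 -> is_subgraph X -> everywhere_percolating X ->
  bernoulli_percolation P eps omega ->
  (n + K * L <= N)%N -> ((2 * N).+1 ^ d < 2 ^ K)%N ->
  ((1 - K%:R * ((2 * N).+1 ^ d)%:R * (1 - eps) ^+ L)%:E <=
   P [set t | box_connected X (omega t) n N])%E.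
Proof.
move=> d2 eps1 Xlat Xperc bern nN dK.
have [omlat _ _ _] := bern.
pose Good := [set t | box_connected X (omega t) n N].
have mGood : measurable Good.
  have -> : Good = [set t | box_connected X
      [set` trace (fset_set (box_edges d N)) (omega t)] n N].
    by apply/seteqP; split=> t /=; apply (box_connected_trace X n N (omlat t)).
  apply: (measurable_trace bern (fun a => box_connected X [set` a] n N)).
  by move=> e /=; rewrite in_fset_set ?inE => [[]|]; last exact: finite_box_edges.
pose Fail (k : nat) (x : vertex d) :=
  [set t | stage_failure X (N - k.+1 * L) L N x (omega t)].
have PFail k x :
    measurable (Fail k x) /\ (P (Fail k x) <= ((1 - eps) ^+ L)%:E)%E.
  set s := (N - k.+1 * L)%N.
  pose C (a : {fset edge d}) := box_cluster (X `|` [set` a]) N x.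
  apply: (closed_after_revealing bern (F := flayer d (s + L) N)
    (G := fun a => stage_gaps s L (C a)) (K := fun a => gap_edges s L (C a))).
  - by move=> e /= /in_flayer /layer_box_edges[].
  - exact: eps1.
  - by move=> a _; apply: gap_edges_spec.
pose FailAt k := \bigcup_(x in [set` (fbox d N : seq _)]) Fail k x.
pose Bad := \bigcup_(k in [set` iota 0 K]) FailAt k.
have nE : #|` fbox d N|%:R <= ((2 * N).+1 ^ d)%:R :> R.
  by rewrite ler_nat; exact: card_fbox.
have PFailAt k : measurable (FailAt k) /\
    (P (FailAt k) <= (((2 * N).+1 ^ d)%:R * (1 - eps) ^+ L)%:E)%E.
  have [mF PF] := prob_bigcup_bound (P := P) (fbox d N) (PFail k).
  split=> //; apply: le_trans PF _; rewrite lee_fin ler_wpM2r //.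
  by rewrite exprn_ge0 // subr_ge0.
have [mBad PBad] := prob_bigcup_bound (P := P) (iota 0 K) PFailAt.
have BadGood : ~` Bad `<=` Good.
  move=> t nBad; apply: (all_stages_connect d2 Xlat Xperc nN dK) => k x kK xN tF.
  apply: nBad; exists k; first by rewrite /= mem_iota.
  by exists x => //=; apply/in_fbox.
apply: (@le_trans _ _ (P (~` Bad))); last first.
  by apply: le_measure => //; rewrite inE //; exact: measurableC.
rewrite probability_setC // EFinB; apply: leeB => //.
by move: PBad; rewrite size_iota mulrA.
Qed.

(** The prefactor is at most [5 ^ d * s ^ (2d + 1)] with [s] the square root of
    [n], and [s ^ m] is absorbed by half of the exponential rate, since
    [b * s <= exp (b * s)] to the power [m] gives
    [(b * s) ^ m <= exp (m * b * s)]; the value of [b] makes [m * b] equal to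
    [del / 2]. *)
Lemma poly_exp_bound (R : realType) (d : nat) (del : R) : 0 < del ->
  exists2 C : R, 0 < C & forall n L : nat, (1 <= n)%N ->
    L%:R <= Num.sqrt (n%:R : R) < L.+1%:R ->
    L%:R * ((2 * (2 * n)).+1 ^ d)%:R * expR (- (del * L%:R)) <=
    C * expR (- (del / 2 * Num.sqrt n%:R)).
Proof.
move=> del0; pose m := (2 * d).+1.
pose b : R := del / (2 * m%:R).
have b0 : 0 < b by rewrite divr_gt0 // mulr_gt0.
exists (5 ^+ d * expR del * b^-1 ^+ m) => [|n L n1].
  by rewrite !mulr_gt0 ?exprn_gt0 ?expR_gt0 ?invr_gt0.
set s := Num.sqrt _ => /andP[Ls sL].
have s1 : 1 <= s by rewrite -sqrtr1 ler_sqrt // ler1n.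
have s0 : 0 <= s by apply: le_trans s1.
have sn : s ^+ 2 = n%:R by rewrite sqr_sqrtr.
have poly : L%:R * ((2 * (2 * n)).+1 ^ d)%:R <= 5 ^+ d * s ^+ m.
  rewrite natrX /m exprS mulrCA exprM -exprMn; apply: ler_pM => //.
  rewrite lerXn2r ?nnegrE //; first by rewrite mulr_ge0 ?sqr_ge0.
  by rewrite sn -natrM ler_nat; lia.
have powexp : s ^+ m <= b^-1 ^+ m * expR (del / 2 * s).
  have -> : del / 2 * s = m%:R * (b * s).
    have : m%:R != 0 :> R by rewrite pnatr_eq0.
    by rewrite /b; move: (m%:R : R) => M M0; field.
  rewrite expRM_natl -exprMn lerXn2r ?nnegrE //.
    by rewrite mulr_ge0 ?expR_ge0 // invr_ge0 ltW.
  rewrite -[leLHS]mul1r -(mulVf (lt0r_neq0 b0)) -mulrA.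
  rewrite ler_pM2l ?invr_gt0 //; apply: le_trans (expR_ge1Dx _).
  by rewrite lerDr.
have expL : expR (- (del * L%:R)) <= expR del * expR (- (del * s)).
  rewrite -expRD ler_expR; rewrite -natr1 in sL.
  have : del * s <= del * (L%:R + 1) by rewrite ler_pM2l // ltW.
  lra.
apply: (@le_trans _ _ (5 ^+ d * (b^-1 ^+ m * expR (del / 2 * s)) *
    (expR del * expR (- (del * s))))).
  apply: ler_pM; rewrite ?mulr_ge0 ?expR_ge0 //.
  by apply: le_trans poly _; rewrite ler_pM2l // exprn_gt0.
have -> : expR (- (del * s)) = expR (- (del / 2 * s)) * expR (- (del / 2 * s)).
  by rewrite -expRD; congr expR; field.
have e1 : expR (del / 2 * s) * expR (- (del / 2 * s)) = 1.
  by rewrite -expRD subrr expR0.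
move: (expR (del / 2 * s)) (expR (- (del / 2 * s))) e1 => p q pq.
rewrite le_eqVlt; apply/orP; left; apply/eqP.
transitivity (5 ^+ d * expR del * b^-1 ^+ m * ((p * q) * q)); last first.
  by rewrite pq mul1r.
ring.
Qed.

Theorem lemma1p1 (R : realType) (d : nat) (eps : R) :
  (2 <= d)%N -> 0 < eps <= 1 ->
  exists C1 C3 : R,
    [/\ 0 < C1, 0 < C3
      & forall X : set (edge d),
          is_subgraph X -> everywhere_percolating X ->
        forall (disp : measure_display) (T : measurableType disp)
          (P : probability T R) (omega : T -> set (edge d)),
          bernoulli_percolation P eps omega ->
        forall n : nat, (1 <= n)%N ->
          ((1 - C3 * expR (- (C1 * Num.sqrt n%:R)))%:E <=
           P [set t | forall x y : vertex d, box d n x -> box d n y ->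
                connected_inside (X `|` omega t) (box d (2 * n)) x y])%E].
Proof.
move=> d2 /andP[eps0 eps1]; pose del := eps / 2.
have del0 : 0 < del by rewrite divr_gt0.
have [C C0 bound] := poly_exp_bound d del0.
exists (del / 2), C; split=> //; first by rewrite divr_gt0.
move=> X Xlat Xperc disp T P omega bern n n1.
set s := Num.sqrt _; pose L := Num.truncn s.
have s1 : 1 <= s by rewrite -sqrtr1 ler_sqrt // ler1n.
have s0 : 0 <= s by apply: le_trans s1.
have Ls := truncn_itv s0; have {}bound := bound n L n1 Ls.
have L1 : (1 <= L)%N by rewrite truncn_gt0.
have LLn : (L * L <= n)%N.
  rewrite -(ler_nat R) natrM -[leRHS]sqr_sqrtr // -/s expr2.
  by case/andP: Ls => Ls _; exact: ler_pM.
have delL : expR (- (del * L%:R)) = expR (- del) ^+ L.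
  by rewrite -mulNr mulrC expRM_natl.
(* If [2 ^ L] does not exceed the volume of the box, the claimed bound is
   vacuous for the same constants: the rate [del <= 1 / 2] was chosen so that
   [exp (- del) >= 1 / 2]. *)
have [dL|dL] := ltnP ((2 * (2 * n)).+1 ^ d) (2 ^ L).
  have nN : (n + L * L <= 2 * n)%N by rewrite mul2n -addnn leq_add2l.
  apply: le_trans (prob_box_connected d2 eps1 Xlat Xperc bern nN dL).
  rewrite lee_fin lerD2l lerN2; apply: le_trans bound.
  rewrite ler_wpM2l ?mulr_ge0 // delL lerXn2r ?nnegrE ?expR_ge0 ?subr_ge0 //.
  apply: le_trans (expR_ge1Dx _); rewrite lerD2l lerN2 /del; lra.
apply: (@le_trans _ _ 0%E); last exact: measure_ge0.
rewrite lee_fin subr_le0; apply: le_trans bound.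
have half : 2^-1 <= expR (- del) by apply: le_trans (expR_ge1Dx _); rewrite /del; lra.
have h1 : (1 : R) <= ((2 * (2 * n)).+1 ^ d)%:R * expR (- (del * L%:R)).
  have two0 : (2 : R) ^+ L != 0 by rewrite expf_neq0 // pnatr_eq0.
  rewrite delL -[leLHS](mulfV two0) -exprVn.
  apply: ler_pM; rewrite ?exprn_ge0 ?invr_ge0 //.
    by rewrite -natrX ler_nat.
  by rewrite lerXn2r ?nnegrE ?expR_ge0 ?invr_ge0.
rewrite -mulrA -[leLHS]mul1r; apply: ler_pM => //.
by rewrite ler1n.
Qed.
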